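(* Let $A$ be a closed semi-algebraic subset of $\mathbb{R}^n$ and let $f\in\mathbb{R}[x]$, $x=(x_1,\dots,x_n)$. Then $\dim(f(A))=\dim(Z(f(A)))$. Moreover, if $f(A)$ is finite, then $f(A)=Z(f(A))$.
   Context: For a subset $B$ of $\mathbb{R}^N$, $Z(B)$ is its Zariski closure: the smallest real variety (set of common real zeros of finitely many real polynomials) containing $B$; here it is taken in $\mathbb{R}$. The dimension of a semi-algebraic set $S$ is the highest dimension at points at which $S$ is a real submanifold; the empty set is given dimension $0$. *)

(* Defs.v *)
From HB Require Import structures.
From mathcomp Require Import all_boot all_order all_algebra.
From mathcomp Require Import all_classical all_reals all_analysis.
(* The notations of mpoly clash with those of MathComp-Analysis. *)
From mathcomp.multinomials Require Import -(notations) mpoly.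
Set Implicit Arguments.
Unset Strict Implicit.
Unset Printing Implicit Defensive.
Import Order.TTheory GRing.Theory Num.Theory.
Import numFieldNormedType.Exports.
Local Open Scope classical_set_scope.
Local Open Scope ring_scope.

(* R^n is 'rV[R]_n; its matrix topology is the product (Euclidean) one. *)
Definition peval (R : realType) (n : nat) (p : mpoly n R) (x : 'rV[R]_n) : R :=
  meval (fun i => x ord0 i) p.

(* A finite union of sets, each defined by finitely many polynomial equations
   (the polynomials in PQ.1) and strict inequalities (those in PQ.2). *)
Definition semialgebraic (R : realType) (n : nat) (S : set 'rV[R]_n) : Prop :=
  exists s : seq (seq (mpoly n R) * seq (mpoly n R)),
    S = [set x | has (fun PQ => all (fun p => peval p x == 0) PQ.1
                             && all (fun q => 0 < peval q x) PQ.2) s].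

Definition real_variety (R : realType) (n : nat) (V : set 'rV[R]_n) : Prop :=
  exists s : seq (mpoly n R), V = [set x | all (fun p => peval p x == 0) s].

(* [smallest] is the intersection of all real varieties containing B; it is
   itself a real variety by Hilbert's basis theorem. *)
Definition zariski_closure (R : realType) (n : nat) (B : set 'rV[R]_n) :
    set 'rV[R]_n :=
  smallest (@real_variety R n) B.

(* k-fold continuous differentiability on U, meant for U open: all iterated
   partial derivatives up to order k exist and are continuous on U. *)
Fixpoint C_k (R : realType) (n k : nat) (U : set 'rV[R]_n) (g : 'rV[R]_n -> R)
    {struct k} : Prop :=
  (forall x, U x -> {for x, continuous g}) /\
  if k is k'.+1 then
    forall i : 'I_n,
      (forall x, U x -> derivable g x (delta_mx ord0 i)) /\
      C_k k' U (fun x => 'D_(delta_mx ord0 i) g x)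
  else True.

Definition smooth_on (R : realType) (n m : nat) (U : set 'rV[R]_n)
    (F : 'rV[R]_n -> 'rV[R]_m) : Prop :=
  forall (k : nat) (j : 'I_m), C_k k U (fun x => F x ord0 j).

(* Near its point x, S is a smooth embedded submanifold of R^n of dimension d:
   a diffeomorphism phi from an open neighbourhood U of x onto an open set V,
   with inverse psi, carries S to the set where the coordinates of index >= d
   (counted from 0) vanish. *)
Definition submanifold_at (R : realType) (n : nat) (S : set 'rV[R]_n)
    (x : 'rV[R]_n) (d : nat) : Prop :=
  [/\ S x, (d <= n)%N &
    exists (U V : set 'rV[R]_n) (phi psi : 'rV[R]_n -> 'rV[R]_n),
      [/\ [/\ open U, U x & open V],
          [/\ smooth_on U phi & forall y, U y -> V (phi y) /\ psi (phi y) = y],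
          [/\ smooth_on V psi & forall z, V z -> U (psi z) /\ phi (psi z) = z] &
          forall y, U y ->
            S y <-> (forall j : 'I_n, (d <= j)%N -> phi y ord0 j = 0)]].

(* The highest dimension at the points where S is a submanifold. The maximum
   over no dimension at all is 0, so that the empty set has dimension 0. *)
Definition semialg_dim (R : realType) (n : nat) (S : set 'rV[R]_n) : nat :=
  \max_(d < n.+1 | `[< exists x, submanifold_at S x d >]) d.

(* f(A), with the real line seen as R^1. *)
Definition poly_image (R : realType) (n : nat) (f : mpoly n R)
    (A : set 'rV[R]_n) : set 'rV[R]_1 :=
  (fun x => const_mx (peval f x)) @` A.

(* Main.v *)
(* If f(A) is finite it is a variety, hence its own Zariski closure.  Otherwise,
   Tarski-Seidenberg makes f(A) the solution set of a quantifier-free formula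
   in one variable; away from the roots of the finitely many nonzero
   polynomials of that formula, membership in f(A) is locally constant, so the
   infinite set f(A) contains an interval.  Then f(A) and its Zariski closure
   both have nonempty interior in R, and hence dimension 1. *)
Require Import Defs.
From mathcomp Require Import all_boot all_order all_algebra.
From mathcomp Require Import all_classical all_reals all_analysis.
From mathcomp.multinomials Require Import -(notations) mpoly.
From mathcomp.real_closed Require Import -(notations) ordered_qelim qe_rcf polyrcf.
Import Order.TTheory GRing.Theory Num.Theory.
Import numFieldNormedType.Exports.
Local Open Scope classical_set_scope.
Local Open Scope ring_scope.

(** A coordinate is linear, so its difference quotient is constant for nonzero increments. *)
Lemma derive_coord (R : realType) (n : nat) (j : 'I_n) (x v : 'rV[R]_n) :
  'D_v (fun y : 'rV[R]_n => y ord0 j) x = v ord0 j.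
Proof.
apply: cvg_lim => //; apply: cvg_near_cst.
near=> h; rewrite /= !mxE addrK -[_ *: _]/(h^-1 * _) mulKf//.
by near: h; exact: nbhs_dnbhs_neq.
Unshelve. all: by end_near. Qed.

Lemma C_k_cst (R : realType) (n k : nat) (U : set 'rV[R]_n) (c : R) :
  C_k k U (fun=> c).
Proof.
elim: k c => [|k IH] c; split => [x _|]; try exact: cst_continuous; first by [].
move=> i; split=> [x _|]; first exact: derivable_cst.
rewrite [X in C_k _ _ X](_ : _ = fun=> 0) //.
by apply/funext => x; exact: derive_cst.
Qed.

Lemma smooth_on_id (R : realType) (n : nat) (U : set 'rV[R]_n) :
  smooth_on U idfun.
Proof.
move=> k j; case: k => [|k]; split => [x _|]; try exact: coord_continuous; first by [].
move=> i; split=> [x _|].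
  exact/diff_derivable/(@differentiable_coord R 1 n x ord0 j).
rewrite [X in C_k _ _ X](_ : _ = fun=> (delta_mx ord0 i : 'rV_n) ord0 j); last first.
  by apply/funext => x; exact: derive_coord.
exact: C_k_cst.
Qed.

(** The identity is a chart on [S^°]: with [d = n] no coordinate is required to vanish. *)
Lemma semialg_dim_interior (R : realType) (n : nat) (S : set 'rV[R]_n) :
  S^° !=set0 -> semialg_dim S = n.
Proof.
move=> [x Sx]; apply/eqP; rewrite eqn_leq; apply/andP; split.
  by apply/bigmax_leqP => d _; rewrite -ltnS.
apply: (@leq_bigmax_cond _ _ (fun d : 'I_n.+1 => d : nat) ord_max).
apply/asboolP; exists x; split => //=; first exact: nbhs_singleton.
exists S^°, S^°, idfun, idfun; split.
- by split => //; exact: open_interior.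
- by split => //; exact: smooth_on_id.
- by split => //; exact: smooth_on_id.
move=> y Sy; split => [_ j|_]; last exact: nbhs_singleton.
by rewrite leqNgt ltn_ord.
Qed.

(** The product of the [X - c], for [c] in [S], vanishes exactly on [S]. *)
Lemma real_variety_finite (R : realType) (S : set 'rV[R]_1) :
  finite_set S -> real_variety S.
Proof.
move=> /finite_seqP[s ->].
exists [:: \prod_(c <- s) (mpolyX R (mnm1 ord0) - mpolyC 1 (c ord0 ord0))].
apply/seteqP; split=> x /=; rewrite andbT /peval rmorph_prod prodf_seq_eq0 /=.
  move=> sx; apply/hasP; exists x => //.
  by rewrite mevalB mevalXU mevalC subrr.
move=> /hasP[c sc]; rewrite mevalB mevalXU mevalC subr_eq0 => /eqP xc.
suff -> : x = c by [].
by apply/rowP => i; rewrite ord1.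
Qed.

Lemma peval_term (R : realType) (n : nat) (p : mpoly n R) :
  exists t : GRing.term R, forall e : seq R,
    GRing.eval e t = peval p (\row_i e`_i).
Proof.
rewrite /peval; elim/mpolyind: p => [|c m p _ _ [t tE]].
  by exists (GRing.Const 0) => e; rewrite meval0.
have [u uE] : exists u : GRing.term R, forall e : seq R,
    GRing.eval e u = \prod_(i < n) e`_i ^+ m i.
  elim: (index_enum _) => [|i r [u uE]].
    by exists (GRing.Const 1) => e; rewrite big_nil.
  exists (GRing.Mul (GRing.Exp (GRing.Var R i) (m i)) u) => e.
  by rewrite big_cons /= uE.
exists (GRing.Add (GRing.Mul (GRing.Const c) u) t) => e /=.
rewrite tE uE mevalD mevalZ mevalX; congr (_ * _ + _).
by apply: eq_bigr => i _; rewrite mxE.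
Qed.

(** The exceptional points are confined to the roots of [q], a finite set; with polynomials, a union
    of exceptional sets becomes a product. *)
Definition generically_locally_constant (R : realType) (b : R -> bool) : Prop :=
  exists2 q : {poly R}, q != 0 &
    forall y : R, q.[y] != 0 -> \forall z \near y, b z = b y.

Lemma generically_locally_constant_op (R : realType) (op : bool -> bool -> bool)
    (b c : R -> bool) :
  generically_locally_constant R b -> generically_locally_constant R c ->
  generically_locally_constant R (fun y => op (b y) (c y)).
Proof.
move=> [p p0 bp] [q q0 cq]; exists (p * q); first by rewrite mulf_neq0.
move=> y; rewrite hornerM mulf_eq0 negb_or => /andP[py qy].
by apply: filterS2 (bp y py) (cq y qy) => z -> ->.
Qed.

(** A polynomial keeps its sign near any point that is not a root. The zero polynomial has constant
    sign, hence no exceptional point. *)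
Lemma generically_locally_constant_sgr (R : realType) (op : R -> bool)
    (p : {poly R}) :
  generically_locally_constant R (fun y => op (Num.sg p.[y])).
Proof.
have [->|p0] := eqVneq p 0.
  exists 1; first exact: oner_neq0.
  by move=> y _; apply: filterE => z; rewrite !horner0.
exists p => // y; case: (sgrP p.[y]) => // py _.
- have : \forall z \near y, 0 < p.[z] by exact: cvgr_gt (@continuous_horner R p y) _ py.
  by apply: filterS => z pz; rewrite gtr0_sg.
- have : \forall z \near y, p.[z] < 0 by exact: cvgr_lt (@continuous_horner R p y) _ py.
  by apply: filterS => z pz; rewrite ltr0_sg.
Qed.

(** With the other variables fixed by [e], each atom is a condition on the sign of one polynomial in
    [y]. *)
Lemma generically_locally_constant_qf (R : realType) (e : seq R) (i : nat)
    (F : ord.formula R) :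
  ord.qf_form F -> ord.rformula F ->
  generically_locally_constant R (fun y => ord.qf_eval (set_nth 0 e i y) F).
Proof.
(* [abstrX] reads a term without inverses as a polynomial in variable [i]. *)
have tE t y : GRing.rterm t ->
    GRing.eval (set_nth 0 e i y) t = (eval_poly e (abstrX i (to_rterm t))).[y].
  by move=> rt; rewrite abstrXP evalE to_rtermE.
have subE t u op : GRing.rterm t -> GRing.rterm u ->
    generically_locally_constant R (fun y =>
      op (Num.sg (GRing.eval (set_nth 0 e i y) t - GRing.eval (set_nth 0 e i y) u))).
  move=> rt ru; under eq_fun do rewrite !tE// -hornerN -hornerD.
  exact: generically_locally_constant_sgr.
elim: F => //=.
- by move=> b _ _; exists 1; [exact: oner_neq0|move=> y _; exact: filterE].
- move=> t u _ /andP[rt ru]; under eq_fun do rewrite -subr_eq0 -sgr_eq0.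
  exact: (subE t u (fun s => s == 0)).
- move=> t u _ /andP[rt ru]; under eq_fun do rewrite -subr_lt0 -sgr_lt0.
  exact: (subE t u (fun s => s < 0)).
- move=> t u _ /andP[rt ru]; under eq_fun do rewrite -subr_le0 -sgr_le0.
  exact: (subE t u (fun s => s <= 0)).
- move=> f IHf g IHg /andP[/IHf{}IHf /IHg{}IHg] /andP[/IHf{}IHf /IHg{}IHg].
  exact: (generically_locally_constant_op _ andb).
- move=> f IHf g IHg /andP[/IHf{}IHf /IHg{}IHg] /andP[/IHf{}IHf /IHg{}IHg].
  exact: (generically_locally_constant_op _ orb).
- move=> f IHf g IHg /andP[/IHf{}IHf /IHg{}IHg] /andP[/IHf{}IHf /IHg{}IHg].
  exact: (generically_locally_constant_op _ implb).
- move=> f IHf /IHf{}IHf /IHf{}IHf.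
  (* Negation is seen as a binary operation that ignores its second argument. *)
  exact: (generically_locally_constant_op _ (fun b _ => ~~ b) _ _ IHf IHf).
Qed.

(** If the interior were empty, every point where [b] holds would be a root of [q], and these are
    finitely many. *)
Lemma infinite_interior (R : realType) (b : R -> bool) :
  generically_locally_constant R b -> infinite_set [set y | b y] ->
  [set y | b y]^° !=set0.
Proof.
move=> [q q0 bq] inf; apply: contrapT => int0; apply: inf.
apply: (@sub_finite_set _ _ [set` rootsR q]); last exact: finite_seq.
move=> y /= by_; rewrite -(roots_on_rootsR q0 y) /=.
apply: contrapT => /negP qy; apply: int0; exists y.
by move: (bq y qy); apply: filterS => z /= ->.
Qed.

Lemma holds_Exists_iota (R : realType) (n : nat) (F : ord.formula R) (e : seq R) :
  ord.holds e (foldr (@ord.Exists R) F (iota 0 n)) <->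
  exists e', (forall i, (n <= i)%N -> e'`_i = e`_i) /\ ord.holds e' F.
Proof.
elim: n F => [|n IH] F.
  split=> [eF|[e' [e'E e'F]]]; first by exists e.
  by apply: ord.eq_holds e'F => i; exact: e'E.
(* The innermost quantifier, on variable [n], is absorbed into the formula before induction
   applies. *)
rewrite -addn1 iotaD add0n foldr_cat /= IH; split.
  move=> [e' [e'E /= [x xF]]]; exists (set_nth 0 e' n x); split=> // i.
  by rewrite addn1 nth_set_nth /= => ni; rewrite gtn_eqF// e'E// ltnW.
(* Entry [n] is reset to that of [e]; its old value becomes the witness for the innermost
   quantifier. *)
move=> [e' [e'E e'F]]; exists (set_nth 0 e' n e`_n); split=> [i ni|/=].
  rewrite nth_set_nth /=; case: eqP => [->//|/eqP ni'].
  by rewrite e'E// addn1 ltn_neqAle eq_sym ni' ni.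
exists e'`_n; apply: ord.eq_holds e'F => i.
by rewrite set_set_nth eqxx nth_set_nth /=; case: eqP => [->|].
Qed.

Lemma semialgebraic_formula (R : realType) (n : nat) (A : set 'rV[R]_n) :
  semialgebraic A ->
  exists F : ord.formula R, forall e, ord.holds e F <-> A (\row_i e`_i).
Proof.
move=> [s ->].
have eqF (ps : seq (mpoly n R)) : exists F : ord.formula R, forall e,
    ord.holds e F <-> all (fun p => peval p (\row_i e`_i) == 0) ps.
  elim: ps => [|p ps [F FE]]; first by exists (ord.Bool true).
  have [t tE] := peval_term R n p.
  exists (ord.And (ord.Equal t (GRing.Const 0)) F) => e /=.
  by rewrite FE tE; split => [[/eqP-> ->]|/andP[/eqP ? ?]].
have ltF (ps : seq (mpoly n R)) : exists F : ord.formula R, forall e,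
    ord.holds e F <-> all (fun p => 0 < peval p (\row_i e`_i)) ps.
  elim: ps => [|p ps [F FE]]; first by exists (ord.Bool true).
  have [t tE] := peval_term R n p.
  exists (ord.And (ord.Lt (GRing.Const 0) t) F) => e /=.
  by rewrite FE tE; split => [[-> ->]|/andP[? ?]].
elim: s => [|[P Q] s [F FE]]; first by exists (ord.Bool false).
have [FP FPE] := eqF P; have [FQ FQE] := ltF Q.
exists (ord.Or (ord.And FP FQ) F) => e /=; rewrite FE FPE FQE /=.
by split => [[[-> ->]|->]|/orP[/andP[? ?]|?]]; rewrite ?orbT //; [left|right].
Qed.

(** Variables below [n] hold the coordinates of a point of [A] and are quantified; variable [n]
    stays free and holds the value of [f]. *)
Lemma peval_image_formula (R : realType) (n : nat) (A : set 'rV[R]_n)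
    (f : mpoly n R) : semialgebraic A ->
  exists F : ord.formula R, forall y,
    ord.holds (set_nth 0 [::] n y) F <-> (peval f @` A) y.
Proof.
move=> /semialgebraic_formula[FA FAE]; have [t tE] := peval_term R n f.
exists (foldr (@ord.Exists R) (ord.And FA (ord.Equal t (GRing.Var R n))) (iota 0 n)).
move=> y; rewrite holds_Exists_iota; split.
  move=> [e [eE /= [/FAE Ae]]]; rewrite tE eE// nth_set_nth /= eqxx => fe.
  by exists (\row_i e`_i).
move=> [x Ax <-]; pose e := [seq x ord0 i | i <- enum 'I_n].
have size_e : size e = n by rewrite size_map size_enum_ord.
have eE : \row_i (rcons e (peval f x))`_i = x.
  apply/rowP => i; rewrite mxE nth_rcons size_e ltn_ord.
  by rewrite (nth_map i) ?size_enum_ord// nth_ord_enum.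
exists (rcons e (peval f x)); split => [i ni|/=].
  by rewrite nth_rcons nth_set_nth /= size_e ltnNge ni nth_nil.
by rewrite FAE tE eE nth_rcons size_e ltnn eqxx.
Qed.

Lemma peval_image_interior (R : realType) (n : nat) (A : set 'rV[R]_n)
    (f : mpoly n R) : semialgebraic A -> infinite_set (peval f @` A) ->
  (peval f @` A)^° !=set0.
Proof.
move=> /(peval_image_formula R n A f)[F FE].
(* [to_rform] removes inverses, so that the atoms left after elimination are polynomial. *)
pose G := ord.quantifier_elim (@wproj R) (ord.to_rform F).
have /andP[qfG rG] : ord.qf_form G && ord.rformula G.
  exact/(ord.quantifier_elim_wf (@wf_QE_wproj R))/ord.to_rform_rformula.
have -> : peval f @` A = [set y | ord.qf_eval (set_nth 0 [::] n y) G].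
  apply/seteqP; split => y /=.
    by move=> /FE Fy; exact/(rcf_satP _ F).
  by move=> Gy; apply/FE/(rcf_satP _ F).
exact/infinite_interior/generically_locally_constant_qf.
Qed.

Theorem lemma4 (R : realType) (n : nat) (A : set 'rV[R]_n) (f : mpoly n R)
  (A_closed : closed A) (A_semialg : semialgebraic A) :
  semialg_dim (poly_image f A) = semialg_dim (zariski_closure (poly_image f A))
  /\ (finite_set (poly_image f A) ->
      poly_image f A = zariski_closure (poly_image f A)).
Proof.
have finZ : finite_set (poly_image f A) ->
    poly_image f A = zariski_closure (poly_image f A).
  by move=> /real_variety_finite V; rewrite /zariski_closure smallest_id.
split => //; have [/finZ <-//|inf] := pselect (finite_set (poly_image f A)).
have [y fAy] : (poly_image f A)^° !=set0.
  have [y fAy] : (peval f @` A)^° !=set0.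
    apply: peval_image_interior => // fin; apply: inf.
    have -> : poly_image f A = const_mx @` (peval f @` A) by rewrite image_comp.
    exact: finite_image.
  exists (const_mx y).
  (* The interior point passes from the line to ['rV_1] by continuity of the coordinate. *)
  have : nbhs (const_mx y : 'rV[R]_1) [set z : 'rV_1 | (peval f @` A) (z ord0 ord0)].
    by apply: (@coord_continuous R 1 1 ord0 ord0 (const_mx y)); rewrite mxE.
  apply: filterS => z /= [x Ax fx]; exists x => //.
  by rewrite fx; apply/rowP => i; rewrite !ord1 mxE.
(* The Zariski closure contains the image, so [y] is interior to both and both dimensions are 1. *)
rewrite !semialg_dim_interior//; exists y => //.
by apply: filterS fAy; exact: sub_gen_smallest.
Qed.
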